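(* Let $\{A_n\}_n\in\mathscr{E}$ and $g\in\mathscr{M}_D$. If $\{A_n\}_n\sim_\sigma g$, then $\rho(\{A_n\}_n)=p_m(g)$.
   Context: $D\subseteq\mathbb{R}^d$ is a measurable set with finite non-zero Lebesgue measure, and $|\cdot|$ denotes Lebesgue measure. $\mathscr{E}:=\{\{A_n\}_n: A_n\in\mathbb{C}^{n\times n}\}$ is the set of matrix sequences. $\mathscr{M}_D$ is the set of measurable functions $D\to\mathbb{C}$ modulo a.e. equality. For $A\in\mathbb{C}^{n\times n}$ let $\sigma_1(A)\ge\sigma_2(A)\ge\dots\ge\sigma_n(A)$ be its singular values in non-increasing order, and define $p(A):=\min_{i=1,\dots,n}\left\{\frac{i-1}{n}+\sigma_i(A)\right\}$. For $\{A_n\}_n\in\mathscr{E}$ define $\rho(\{A_n\}_n):=\limsup_{n\to\infty}p(A_n)$. For $f\in\mathscr{M}_D$ define $p_m(f):=\inf_E\left\{\frac{|E^C|}{|D|}+\operatorname{ess\,sup}_E|f|\right\}$, where the infimum is taken over all measurable sets $E\subseteq D$ and $E^C$ is the complement of $E$ (in $D$). We write $\{A_n\}_n\sim_\sigma g$ ($g$ is a spectral symbol of $\{A_n\}_n$) if $\lim_{n\to\infty}\frac1n\sum_{i=1}^nF(\sigma_i(A_n))=\frac1{|D|}\int_DF(|g(x)|)\,dx$ for every continuous function $F:\mathbb{R}\to\mathbb{C}$ with compact support.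
   Formalization: p(A) is the minimum over i=1,…,n+1 with σ_{n+1}(A)=0, i.e. min(p(A),1), and ess sup over a null set E is 0; with i≤n the claim fails, as 10·I_n and diag(10,…,10,0) share the symbol 10 but have ρ=10 and ρ=1. *)

(* Defs.v *)
From HB Require Import structures.
From mathcomp Require Import all_boot all_order all_algebra.
From mathcomp Require Import all_classical all_reals all_analysis.
From mathcomp Require Import ess_sup_inf complex.

Set Implicit Arguments.
Unset Strict Implicit.
Unset Printing Implicit Defensive.

Import Order.TTheory GRing.Theory Num.Theory.
Import numFieldNormedType.Exports.
Import ComplexField.

Local Open Scope classical_set_scope.
Local Open Scope ring_scope.

Section lebesgue_measure_Rd.
Context {R : realType} (d : nat).
Local Notation Rd := 'rV[R]_d.+1.

Definition box (ab : Rd * Rd) : set Rd :=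
  [set x | forall i, ab.1 0 i < x 0 i <= ab.2 0 i].

(* An empty box, in particular one with ab.2 0 i < ab.1 0 i for some i,
   has volume 0. *)
Definition box_volume (ab : Rd * Rd) : R :=
  \prod_i Num.max 0 (ab.2 0 i - ab.1 0 i).

Local Open Scope ereal_scope.

Definition lebesgue_outer (X : set Rd) : \bar R :=
  ereal_inf [set \sum_(k <oo) (box_volume (ab k))%:E |
             ab in [set ab : nat -> Rd * Rd | X `<=` \bigcup_k box (ab k)]].

Lemma box_volume_ge0 ab : 0 <= (box_volume ab)%:E.
Proof. by rewrite lee_fin; apply: prodr_ge0 => i _; rewrite le_max lexx. Qed.

Lemma lebesgue_outer_ge0 X : 0 <= lebesgue_outer X.
Proof.
apply: le_ereal_inf_tmp => _ [ab _ <-].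
by apply: nneseries_ge0 => *; exact: box_volume_ge0.
Qed.

Lemma lebesgue_outer0 : lebesgue_outer set0 = 0.
Proof.
apply/eqP; rewrite eq_le lebesgue_outer_ge0 andbT.
apply: ereal_inf_lbound; exists (fun=> (0, 0)%R) => //.
apply: eseries0 => k _ _.
by rewrite /box_volume (bigD1 ord0)//= subrr maxxx mul0r.
Qed.

Lemma le_lebesgue_outer : {homo lebesgue_outer : X Y / X `<=` Y >-> X <= Y}.
Proof.
move=> X Y XY; apply/ereal_inf_le_tmp => _ [ab /= Yab <-].
by exists ab => //=; exact: subset_trans Yab.
Qed.

Lemma lebesgue_outer_sigma_subadditive : sigma_subadditive lebesgue_outer.
Proof.
move=> A; have [[i ioo]|] := pselect (exists i, lebesgue_outer (A i) = +oo).
  rewrite (eseries_pinfty _ _ ioo) ?leey// => n _.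
  by rewrite -ltNye (lt_le_trans _ (lebesgue_outer_ge0 _)).
rewrite -forallNE => Aoo.
apply/lee_addgt0Pr => _/posnumP[e].
rewrite (le_trans _ (epsilon_trick _ _ _))//; last first.
  by move=> n; exact: lebesgue_outer_ge0.
pose P n (B : nat -> Rd * Rd) := A n `<=` \bigcup_k box (B k) /\
  \sum_(k <oo) (box_volume (B k))%:E
    <= lebesgue_outer (A n) + (e%:num / (2 ^ n.+1)%:R)%:E.
have [G PG] : {G : nat -> nat -> Rd * Rd & forall n, P n (G n)}.
  apply: (@choice _ _ P) => n; rewrite /P.
  have fA : lebesgue_outer (A n) \is a fin_num.
    by rewrite ge0_fin_numE ?lebesgue_outer_ge0// ltey; apply/eqP/Aoo.
  have en1 : (0 < e%:num / (2 ^ n.+1)%:R :> R)%R by [].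
  have [_ [B AB <-] Blt] := lb_ereal_inf_adherent en1 fA.
  by exists B; split => //; exact: ltW.
pose v (ij : nat * nat) : \bar R := (box_volume (G ij.1 ij.2))%:E.
have v0 x : 0 <= v x by exact: box_volume_ge0.
apply: (@le_trans _ _ (\esum_(i in setT) v i)).
  have /card_esym/ppcard_eqP[f] := card_nat2.
  apply: ereal_inf_lbound => /=.
  exists (fun k => G (f k).1 (f k).2).
    move=> t [i _ /(PG i).1 [j _ Gt]].
    by exists (f^-1%FUN (i, j)) => //=; rewrite invK ?inE.
  rewrite (_ : \sum_(k <oo) _ = \sum_(k <oo) (v \o f) k)//.
  rewrite -(esum_pred_image v _ xpredT) ?[fun=> _]set_true//.
  by rewrite image_eq.
rewrite (_ : esum _ _ = \sum_(i <oo) \sum_(j <oo) v (i, j)); last first.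
  pose J : nat -> set (nat * nat) := fun i => [set (i, j) | j in setT].
  rewrite (_ : setT = \bigcup_k J k); last first.
    by rewrite predeqE => -[a b]; split => // _; exists a => //; exists b.
  rewrite esum_bigcupT//=; last first.
    apply/trivIsetP => i j _ _ ij.
    rewrite predeqE => -[n m] /=; split => //= -[] [_] _ [<-{n} _].
    by move=> [m' _] [] /esym/eqP; rewrite (negbTE ij).
  rewrite -(image_id [set: nat]) -fun_true esum_pred_image//; last first.
    by move=> n _; exact: esum_ge0.
  apply: eq_eseriesr => /= j _.
  rewrite -(esum_pred_image v (pair j) predT)//=; last first.
    by move=> ? ? _ _; exact: (@can_inj _ _ _ snd).
  by congr esum; rewrite predeqE => -[a b]; split; move=> [i _ <-]; exists i.
apply: lee_nneseries => i _; last exact: (PG i).2.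
by move=> _; apply: nneseries_ge0 => j _ _; exact: v0.
Qed.

HB.instance Definition _ := isOuterMeasure.Build R Rd lebesgue_outer
  lebesgue_outer0 lebesgue_outer_ge0 le_lebesgue_outer
  lebesgue_outer_sigma_subadditive.

(* R^(d.+1) with the (complete) sigma-algebra of Lebesgue measurable sets. *)
Definition lebesgue_Rd : measurableType _ := caratheodory_type lebesgue_outer.

Definition lebesgue_measure_Rd : set lebesgue_Rd -> \bar R := lebesgue_outer.

Let lebesgue_measure_Rd0 : lebesgue_measure_Rd set0 = 0.
Proof. exact: lebesgue_outer0. Qed.

Let lebesgue_measure_Rd_ge0 X : 0 <= lebesgue_measure_Rd X.
Proof. exact: lebesgue_outer_ge0. Qed.

Let lebesgue_measure_Rd_semi_sigma_additive :
  semi_sigma_additive lebesgue_measure_Rd.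
Proof. by move=> F mF tF mUF; exact: caratheodory_measure_sigma_additive. Qed.

HB.instance Definition _ := isMeasure.Build _ _ _ lebesgue_measure_Rd
  lebesgue_measure_Rd0 lebesgue_measure_Rd_ge0
  lebesgue_measure_Rd_semi_sigma_additive.

End lebesgue_measure_Rd.

Arguments lebesgue_Rd R d : clear implicits.
Arguments lebesgue_measure_Rd R d : clear implicits.

Section singular_values.
Context {R : realType} (n : nat).
Local Open Scope sesquilinear_scope.

(* The square roots of the eigenvalues of A^* A, counted with multiplicity,
   in non-increasing order; A^* A is hermitian, hence normal, so spectral_diag
   is the diagonal of a unitary diagonalization of it. *)
Definition singular_values (A : 'M[R[i]]_n) : seq R :=
  sort >=%R [seq Num.sqrt (complex.Re (spectral_diag (A ^t* *m A) 0 i))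
            | i <- enum 'I_n].

(* Numbered from 0: singular_value A i is sigma_(i+1)(A), and it is 0 when
   i >= n. *)
Definition singular_value (A : 'M[R[i]]_n) (i : nat) : R :=
  nth 0 (singular_values A) i.

(* min_(1 <= i <= n+1) ((i - 1) / n + sigma_i(A)), where sigma_(n+1)(A) = 0.
   The index n+1, whose term is 1, cannot be dropped: the minimum over i <= n
   is 10 for 10 I_n and (n - 1) / n for diag(10, .., 10, 0), although these two
   sequences of matrices have the same spectral symbol, namely the constant 10.
   The default value of the iterated minimum is its first term. *)
Definition p_mx (A : 'M[R[i]]_n) : R :=
  \big[Num.min/singular_value A 0]_(i < n.+1)
    (i%:R / n%:R + singular_value A i).

End singular_values.

Definition rho {R : realType} (A : forall n, 'M[R[i]]_n) : \bar R :=
  limn_esup (fun n => (p_mx (A n))%:E).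

(* R[i]^o, not R[i], carries the topology of the modulus. *)
Definition borelC (R : realType) : measurableType _ :=
  g_sigma_algebraType (@open R[i]^o).

Section symbols.
Context {R : realType} {d} {T : measurableType d}.
Variables (mu : {measure set T -> \bar R}) (D : set T).

(* Extending |f| by 0 outside E does not change its essential supremum over E,
   except that it is 0 instead of -oo when E is null, as it should be for the
   supremum of a function with values in [0, +oo]. *)
Definition ess_sup_norm (E : set T) (f : T -> R[i]) : \bar R :=
  ess_sup mu ((fun x => (Normc.normc (f x))%:E) \_ E).

Definition p_m (f : T -> R[i]) : \bar R :=
  ereal_inf [set (mu (D `\` E) / mu D + ess_sup_norm E f)%E |
             E in [set E | measurable E /\ E `<=` D]].

Definition Cintegral (f : T -> R[i]) : R[i] :=
  Complex (\int[mu]_(x in D) complex.Re (f x))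
          (\int[mu]_(x in D) complex.Im (f x)).

Definition spectral_symbol (A : forall n, 'M[R[i]]_n) (g : T -> R[i]) : Prop :=
  forall F : R -> R[i]^o,
    continuous F -> compact (closure [set x | F x != 0]) ->
    (n%:R^-1 * \sum_(i < n) F (singular_value (A n) i) : R[i]^o) @[n --> \oo]
      --> ((real_complex R (fine (mu D)))^-1 *
          Cintegral (fun x => F (Normc.normc (g x))) : R[i]^o).

End symbols.

(* Main.v *)
Require Import Defs.
From mathcomp Require Import all_boot all_order all_algebra.
From mathcomp Require Import all_classical all_reals all_analysis.
From mathcomp Require Import complex.
From mathcomp Require Import measurable_realfun ess_sup_inf lra.

(* Let [frac_le t] be |{x in D : |g x| <= t}| / |D|.  The infimum defining
   p_m(g) may be restricted to the sublevel sets of |g|, so that p_m(g) is the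
   infimum over t >= 0 of 1 - frac_le t + t.  Symmetrically, p(A_n) is the
   minimum over t >= 0 of t plus the proportion of singular values exceeding
   t.  The spectral symbol, tested on a continuous ramp equal to 1 on [0, t]
   and to 0 beyond t + e, compares the two distribution functions at nearby
   points.  For rho <= p_m one value of t at a time is enough; for the converse
   the t realizing p(A_n) varies with n in [0, 1], and is replaced by a
   neighbour in a finite grid of mesh e. *)

Import Order.TTheory GRing.Theory Num.Theory.
Import numFieldNormedType.Exports.

Local Open Scope classical_set_scope.
Local Open Scope ring_scope.

(** * Continuous cutoff functions on the real line *)

Section ramp.
Context {R : realType}.
Implicit Types t e x : R.

(** The absolute value bounds the support on both sides, since a spectral symbol is tested on
    functions with compact support in the whole line. *)
Definition ramp t e x : R := Num.min 1 (Num.max 0 ((t + e - `|x|) / e)).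

Lemma ramp_ge0 t e x : 0 <= ramp t e x.
Proof. by rewrite /ramp le_min ler01 le_max lexx. Qed.

Lemma ramp_le1 t e x : ramp t e x <= 1.
Proof. by rewrite /ramp ge_min lexx. Qed.

Lemma ramp_eq1 t e x : 0 < e -> `|x| <= t -> ramp t e x = 1.
Proof.
move=> e0 xt; apply/min_idPl; rewrite le_max; apply/orP; right.
by rewrite ler_pdivlMr// mul1r; lra.
Qed.

Lemma ramp_eq0 t e x : 0 < e -> t + e <= `|x| -> ramp t e x = 0.
Proof.
move=> e0 xt; rewrite /ramp (_ : Num.max _ _ = 0) ?(min_idPr ler01)//.
by apply/max_idPl; rewrite pmulr_lle0 ?invr_gt0//; lra.
Qed.

Lemma continuous_ramp t e : continuous (ramp t e).
Proof.
pose g x : R := (t + e - `|x|) / e.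
change (continuous (cst 1 \min (cst 0 \max g) : R -> R)).
apply: min_fun_continuous; first exact: cst_continuous.
apply: max_fun_continuous; first exact: cst_continuous.
move=> x; apply: cvgMl; apply: cvgB; first exact: cvg_cst.
exact: norm_continuous.
Qed.

Lemma compact_support_ramp t e : 0 < e ->
  compact (closure [set x | ramp t e x != 0]).
Proof.
move=> e0; apply: (@subclosed_compact _ _ `[- (t + e), t + e]).
- exact: closed_closure.
- exact: segment_compact.
- have /closure_id -> : closed `[- (t + e), t + e] by exact: interval_closed.
  apply: closureS => x /=; rewrite in_itv/= -ler_norml.
  by apply: contra_neqT; rewrite -ltNge => /ltW; exact: ramp_eq0.
Qed.

End ramp.

(** * Limit superior under eventual bounds *)

Section limn_esup_near.
Context {R : realType}.

Lemma limn_esup_near_le (u : (\bar R) ^nat) (l : \bar R) :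
  (\forall n \near \oo, (u n <= l)%E) -> (limn_esup u <= l)%E.
Proof.
move=> ul; apply: (@le_trans _ _ (ereal_sup (u @` [set n | (u n <= l)%E]))).
  by apply: ereal_inf_lbound; exists [set n | (u n <= l)%E].
by apply: ge_ereal_sup => _ [n un <-].
Qed.

Lemma le_limn_esup_near (u : (\bar R) ^nat) (l : \bar R) :
  (\forall n \near \oo, (l <= u n)%E) -> (l <= limn_esup u)%E.
Proof.
move=> ul; apply: le_ereal_inf_tmp => _ [V VF <-].
have [n [lun Vn]] := filter_ex (filterI ul VF).
by apply: le_trans lun _; apply: ereal_sup_ubound; exists n.
Qed.

End limn_esup_near.

Lemma sumr_geq_ord (V : nmodType) (n k : nat) (x : V) :
  \sum_(i < n | ~~ (i < k)%N) x = x *+ (n - k).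
Proof.
rewrite -sumr_const_nat big_geq_mkord.
by apply: eq_bigl => i; rewrite -leqNgt.
Qed.

(** * Singular values of one matrix and the minimum [p_mx] *)

Section matrices.
Context {R : realType} {n : nat} (A : 'M[R[i]]_n).

Lemma singular_value_ge0 i : 0 <= singular_value A i.
Proof.
have [i_lt|i_ge] := ltnP i (size (singular_values A)); last first.
  by rewrite /singular_value nth_default.
have := mem_nth 0 i_lt; rewrite -/(singular_value A i) mem_sort.
by move=> /mapP[j _ ->]; exact: sqrtr_ge0.
Qed.

Lemma size_singular_values : size (singular_values A) = n.
Proof. by rewrite size_sort size_map size_enum_ord. Qed.

Lemma singular_value_default i : (n <= i)%N -> singular_value A i = 0.
Proof.
by move=> ni; rewrite /singular_value nth_default// size_singular_values.
Qed.

Lemma singular_value_nonincreasing i j : (i <= j)%N ->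
  singular_value A j <= singular_value A i.
Proof.
move=> ij; have [jn|nj] := ltnP j n; last first.
  by rewrite (singular_value_default _ nj) singular_value_ge0.
have s : sorted >=%R (singular_values A).
  by apply: sort_sorted => x y; exact: le_total.
apply: (sorted_leq_nth _ _ _ s) => //.
- by move=> x y z /= yx zy; exact: le_trans zy yx.
- by move=> x /=.
- by rewrite inE size_singular_values; exact: leq_ltn_trans jn.
- by rewrite inE size_singular_values.
Qed.

Lemma p_mx_le i : (i <= n)%N -> p_mx A <= i%:R / n%:R + singular_value A i.
Proof. by rewrite -ltnS => i_n; exact: (bigmin_le _ (Ordinal i_n)). Qed.

Lemma p_mx_witness : exists2 i : nat,
  (i <= n)%N & p_mx A = i%:R / n%:R + singular_value A i.
Proof.
have t0 : (0 : R) / n%:R + singular_value A 0 = singular_value A 0.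
  by rewrite mul0r add0r.
(* The minimum may also be attained by the default value of the iterated minimum, which is the term
   of index 0. *)
have /bigmin_leP[|[i _]] := lexx (p_mx A) => [le0|le_i].
  by exists 0; [|apply/le_anti; rewrite p_mx_le// t0 le0].
have i_n : (i <= n)%N by rewrite -ltnS ltn_ord.
by exists i; [|apply/le_anti; rewrite le_i p_mx_le].
Qed.

Definition mean_sv (F : R -> R) : R :=
  n%:R^-1 * \sum_(i < n) F (singular_value A i).

(** Let [k] be the first index whose singular value is at most [t + e]. The ramp vanishes at the [k]
    earlier ones, so its mean is at most [1 - k / n], and the term of index [k] bounds [p_mx A]. *)
Lemma p_mx_ramp_le t e : 0 <= t -> 0 < e -> (0 < n)%N ->
  p_mx A <= 1 - mean_sv (ramp t e) + (t + e).
Proof.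
move=> t0 e0 n0.
pose small x := x <= t + e.
pose k := find small (singular_values A).
have kn : (k <= n)%N by rewrite -[leqRHS]size_singular_values find_size.
have sk : singular_value A k <= t + e.
  have [ex|nex] := boolP (has small (singular_values A)).
    exact: (nth_find 0 ex).
  (* No singular value is small, so [k] is [n] and the default value 0 is compared with [t + e]. *)
  rewrite singular_value_default; first by rewrite addr_ge0// ltW.
  by rewrite /k hasNfind// size_singular_values.
apply: le_trans (p_mx_le _ kn) _; apply: lerD => //.
rewrite -(ler_pM2r (_ : 0 < n%:R)) ?ltr0n// divfK ?pnatr_eq0 ?gt_eqF//.
rewrite mulrBl mul1r mulrC mulrA divff ?pnatr_eq0 ?gt_eqF// mul1r.
rewrite lerBrDr -lerBrDl -natrB//.
rewrite (bigID (fun i : 'I_n => (i < k)%N))/= big1 ?add0r.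
  rewrite (le_trans (ler_sum _ (fun i _ => ramp_le1 _ _ _)))//.
  by rewrite sumr_geq_ord.
move=> i ik; apply: ramp_eq0 => //.
rewrite ger0_norm ?singular_value_ge0// ltW//.
by have /negbT := before_find 0 ik; rewrite /small -ltNge.
Qed.

(** Take for [t] the singular value at a minimizing index [i]. By monotonicity the [n - i] values
    from there on are at most [t], so the ramp is 1 at them and its mean is at least [1 - i / n].
    The bound [t <= 1] will make a finite grid sufficient. *)
Lemma ge_p_mx_ramp : (0 < n)%N -> exists2 t, 0 <= t <= 1 &
  forall s e, t <= s -> 0 < e -> 1 - mean_sv (ramp s e) + t <= p_mx A.
Proof.
move=> n0; have [i i_n pE] := p_mx_witness.
(* The term of index [n] equals 1. *)
have p1 : p_mx A <= 1.
  rewrite (le_trans (p_mx_le _ (leqnn n)))// singular_value_default// addr0.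
  by rewrite divff// pnatr_eq0 gt_eqF.
exists (singular_value A i).
  by rewrite singular_value_ge0 (le_trans _ p1)// pE lerDr divr_ge0.
move=> s e ts e0; rewrite pE lerD2r.
rewrite -(ler_pM2r (_ : 0 < n%:R)) ?ltr0n// divfK ?pnatr_eq0 ?gt_eqF//.
rewrite mulrBl mul1r mulrC mulrA divff ?pnatr_eq0 ?gt_eqF// mul1r.
rewrite lerBlDr -lerBlDl -natrB//.
rewrite (bigID (fun j : 'I_n => (j < i)%N))/= ler_wpDl//.
  by apply: sumr_ge0 => *; exact: ramp_ge0.
rewrite (eq_bigr (fun=> 1)).
  by rewrite sumr_geq_ord.
move=> j; rewrite -leqNgt => ij; apply: ramp_eq1 => //.
rewrite ger0_norm ?singular_value_ge0//.
by rewrite (le_trans (singular_value_nonincreasing _ _ ij)).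
Qed.

End matrices.

(** * Modulus and embedding of the reals in the complex numbers *)

Section complex_facts.
Context {R : realType}.

Lemma norm_real_complex (x : R) : `|(x%:C)%C| = (`|x|%:C)%C :> R[i].
Proof. by rewrite normc_def/= expr0n addr0 sqrtr_sqr. Qed.

Lemma normc_ge0 (z : R[i]) : 0 <= Normc.normc z.
Proof. by rewrite -ler0c; exact: (normr_ge0 z). Qed.

Lemma dist_normc (z w : R[i]) :
  `|Normc.normc z - Normc.normc w| <= Normc.normc (z - w).
Proof.
have := le_normcD (z - w) w; have := le_normcD (w - z) z.
rewrite !subrK => h1 h2; rewrite ler_norml; apply/andP; split; last lra.
by rewrite -(normcN (z - w)) opprB; lra.
Qed.

Lemma continuous_normc : continuous (@Normc.normc R : R[i]^o -> R).
Proof.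
move=> z; have fz := @nbhs_filter R[i]^o z.
apply/(@cvgrPdist_lt _ _ _ _ fz) => e e0.
apply/(nbhs_ballP (z : R[i]^o)); exists (e%:C)%C; rewrite /= ?ltcR// => w.
by rewrite -ball_normE/= ltcR; apply: le_lt_trans; exact: dist_normc.
Qed.

Lemma measurable_normc :
  measurable_fun setT (@Normc.normc R : borelC R -> R).
Proof.
apply: (measurability _ (RGenOInfty.measurableE R)).
move=> _ [_ [x ->] <-]; rewrite setTI set_itvoy.
apply: sub_sigma_algebra.
by apply: open_comp => [z _|]; [exact: continuous_normc|exact: open_gt].
Qed.

Lemma real_complex_cvgP (T : Type) (F : set_system T) (FF : Filter F)
    (u : T -> R) (l : R) :
  (u x)%:C%C @[x --> F] --> (l%:C%C : R[i]^o) <-> u x @[x --> F] --> l.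
Proof.
split=> ul.
  apply/cvgrPdist_lt => e e0.
  have e0C : (0 : R[i]) < (e%:C)%C by rewrite ltcR.
  apply: filterS (@cvgr_dist_lt _ R[i]^o _ _ FF _ _ ul _ e0C) => x.
  by rewrite -rmorphB norm_real_complex ltcR.
apply/(@cvgrPdist_lt _ R[i]^o _ _ FF).
(* A positive element of [R[i]] is real, so complex radii reduce to real ones. *)
move=> [e e'] /[dup] /gtr0_real /complex_realP[k ->]; rewrite ltcR => e0.
apply: filterS (cvgr_dist_lt _ _ ul _ e0) => x.
by rewrite -rmorphB norm_real_complex ltcR.
Qed.

Lemma continuous_real_complex (F : R -> R) : continuous F ->
  continuous (fun x => (F x)%:C%C : R[i]^o).
Proof. by move=> cF x; apply/real_complex_cvgP; exact: cF. Qed.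

End complex_facts.

(** * Distribution function of the modulus of [g], and its comparison with the singular values *)

Section distribution_function.
Context {R : realType} {d} {T : measurableType d}.
Variables (mu : {measure set T -> \bar R}) (D : set T).
Variables (A : forall n : nat, 'M[R[i]]_n) (g : T -> R[i]).

Lemma spectral_symbol_real (F : R -> R) : spectral_symbol mu D A g ->
  continuous F -> compact (closure [set x | F x != 0]) ->
  mean_sv (A n) F @[n --> \oo] -->
    (fine (mu D))^-1 * \int[mu]_(x in D) F (Normc.normc (g x)).
Proof.
move=> Ag cF sF; apply/real_complex_cvgP.
have := Ag _ (continuous_real_complex F cF).
have supE : [set x | F x != 0] = [set x | ((F x)%:C)%C != 0 :> R[i]].
  by apply/seteqP; split=> x /=; rewrite fmorph_eq0.
rewrite supE in sF; move=> /(_ sF); rewrite /Cintegral /=.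
have -> : \int[mu]_(x in D) (0 : R) = 0 by rewrite /Rintegral integral0.
rewrite -fmorphV -[X in _ --> X](rmorphM (real_complex R)).
under eq_fun => n do
  rewrite -rmorph_sum/= -(rmorph_nat (real_complex R)) -fmorphV -rmorphM/=.
exact.
Qed.

Hypotheses (mD : measurable D) (D_gt0 : (0 < mu D)%E) (D_fin : (mu D < +oo)%E).
Hypothesis mg : measurable_fun D (g : T -> borelC R).

Definition sublevel t : set T := D `&` [set x | Normc.normc (g x) <= t].

Definition frac_le t : R := fine (mu (sublevel t)) / fine (mu D).

Lemma measurable_modulus : measurable_fun D (fun x => Normc.normc (g x)).
Proof. exact: (measurableT_comp measurable_normc mg). Qed.

Lemma measurable_sublevel t : measurable (sublevel t).
Proof.
have := measurable_modulus mD _ (measurable_itv `]-oo, t]).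
by rewrite set_itvNyc.
Qed.

Lemma fin_mu_sublevel t : mu (sublevel t) \is a fin_num.
Proof.
rewrite ge0_fin_numE//.
apply: le_lt_trans D_fin; apply: le_measure; rewrite ?inE//.
  exact: measurable_sublevel.
by move=> x [].
Qed.

Lemma fine_muD_gt0 : 0 < fine (mu D).
Proof. by rewrite fine_gt0// D_gt0. Qed.

(** On nonnegative arguments the ramp lies between the indicators of [[0, t]] and [[0, t + e]]. *)
Lemma frac_le_bounds t e : 0 < e ->
  let c := (fine (mu D))^-1 * \int[mu]_(x in D) ramp t e (Normc.normc (g x)) in
  frac_le t <= c <= frac_le (t + e).
Proof.
rewrite /= => e0; set c := _^-1 * _.
have G0 x : `|Normc.normc (g x)| = Normc.normc (g x).
  by rewrite ger0_norm// normc_ge0.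
pose f x := ramp t e (Normc.normc (g x)).
have mf : measurable_fun D (EFin \o f).
  apply/measurable_EFinP; apply: measurableT_comp measurable_modulus.
  by apply: continuous_measurable_fun; exact: continuous_ramp.
have mI s : measurable_fun D (EFin \o (\1_(sublevel s) : T -> R)).
  apply/measurable_EFinP; apply: measurable_indic.
  exact: measurable_sublevel.
have ind s : (\int[mu]_(x in D) (\1_(sublevel s) x)%:E = mu (sublevel s))%E.
  rewrite integral_indic//; last exact: measurable_sublevel.
  by rewrite setIC setIA setIid.
have h1 : (mu (sublevel t) <= \int[mu]_(x in D) (f x)%:E)%E.
  rewrite -ind; apply: ge0_le_integral => //; first exact: mI.
  move=> x Dx; rewrite lee_fin indicE; have [xt|xt] := pselect (sublevel t x).
    by rewrite mem_set// /f ramp_eq1// G0; case: xt.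
  by rewrite memNset// ramp_ge0.
have h2 : (\int[mu]_(x in D) (f x)%:E <= mu (sublevel (t + e)%R))%E.
  rewrite -ind; apply: ge0_le_integral => //.
  - by move=> x Dx; rewrite lee_fin ramp_ge0.
  - exact: mI.
  move=> x Dx; rewrite lee_fin indicE.
  have [xt|tx] := leP (Normc.normc (g x)) (t + e).
    by rewrite mem_set ?ramp_le1.
  by rewrite /f ramp_eq0// G0 ltW.
rewrite /frac_le /c !(mulrC (fine (mu D))^-1).
rewrite !ler_pM2r ?invr_gt0 ?fine_muD_gt0//.
have fint : (\int[mu]_(x in D) (f x)%:E)%E \is a fin_num.
  rewrite ge0_fin_numE; last exact: le_trans h1.
  by rewrite (le_lt_trans h2)// -ge0_fin_numE// fin_mu_sublevel.
by rewrite !fine_le ?fin_mu_sublevel.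
Qed.

Lemma frac_gt t :
  (mu (D `\` sublevel t) / mu D)%E = (1 - frac_le t)%:E.
Proof.
have -> : mu (D `\` sublevel t) = (mu D - mu (sublevel t))%E.
  rewrite measureD//; last exact: measurable_sublevel.
  by rewrite setIidr// => x [].
pose M := fine (mu D); have M0 : 0 < M := fine_muD_gt0.
have -> : mu D = M%:E by rewrite fineK// ge0_fin_numE.
rewrite -(fineK (fin_mu_sublevel t)) -EFinB inver gt_eqF// -EFinM mulrBl.
by rewrite divff// gt_eqF.
Qed.

Lemma p_m_le_sublevel t : 0 <= t -> (p_m mu D g <= (1 - frac_le t + t)%:E)%E.
Proof.
move=> t0.
apply: (@le_trans _ _ (mu (D `\` sublevel t) / mu D
                       + ess_sup_norm mu (sublevel t) g)%E).
  apply: ereal_inf_lbound; exists (sublevel t) => //; split.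
    exact: measurable_sublevel.
  by move=> x [].
rewrite EFinD; apply: leeD; last first.
  apply/ess_supP; apply: nearW => x.
  rewrite patchE; case: ifPn => [|_]; last by rewrite lee_fin.
  by rewrite inE => -[]; rewrite lee_fin.
by rewrite frac_gt.
Qed.

(** If [t] is the essential supremum of the modulus over [E], then [E] lies in [sublevel t] up to a
    null set. Replacing [E] by [sublevel t] therefore does not increase the measure of the
    complement. *)
Lemma le_p_m_sublevel (l : \bar R) :
  (forall t, 0 <= t -> (l <= (1 - frac_le t + t)%:E)%E) -> (l <= p_m mu D g)%E.
Proof.
move=> lt; apply: le_ereal_inf_tmp => _ [E [mE ED] <-].
have ess_ge := ess_sup_ge mu ((fun x => (Normc.normc (g x))%:E) \_ E).
rewrite -/(ess_sup_norm mu E g) in ess_ge *.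
have muDE0 : (0 <= mu (D `\` E) / mu D)%E.
  by rewrite mule_ge0// inve_ge0.
have [->|Eoo] := eqVneq (ess_sup_norm mu E g) +oo%E.
  by rewrite addey ?leey// gt_eqF// (lt_le_trans _ muDE0).
have muT0 : (0 < mu setT)%E
  by apply: lt_le_trans D_gt0 _; apply: le_measure; rewrite ?inE.
have ess0 : (0 <= ess_sup_norm mu E g)%E.
  apply: ess_sup_gee => //; apply: nearW => x.
  by rewrite patchE; case: ifP => // _; rewrite lee_fin normc_ge0.
case: (ess_sup_norm mu E g) Eoo ess0 ess_ge => [t| |]// _ t0 ess_ge.
apply: le_trans (lt _ t0) _; rewrite EFinD leeD2r// -frac_gt.
apply: lee_wpmul2r; first by rewrite inve_ge0.
have mDt : measurable (D `\` sublevel t).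
  by apply: measurableD => //; exact: measurable_sublevel.
have mDE : measurable (D `\` E) by exact: measurableD.
have mN : measurable ((D `\` sublevel t) `&` E) by exact: measurableI.
(* On this part of [E] the modulus exceeds its essential supremum [t]. *)
have N0 : mu ((D `\` sublevel t) `&` E) = 0.
  apply: measure_negligible => //.
  apply: negligibleS ess_ge => x /= [[Dx xt] Ex].
  by rewrite patchE mem_set// lee_fin => gxt; exact: xt.
rewrite -[leRHS]adde0 -N0; apply: le_trans (measureU2 _ mDE mN).
apply: le_measure; rewrite ?inE//; first exact: measurableU.
by move=> x [Dx xt]; have [Ex|Ex] := pselect (E x); [right|left].
Qed.

Hypothesis Ag : spectral_symbol mu D A g.

Lemma mean_sv_ramp_near t e eps : 0 < e -> 0 < eps -> \forall n \near \oo,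
  frac_le t - eps <= mean_sv (A n) (ramp t e) <= frac_le (t + e) + eps.
Proof.
move=> e0 eps0; have /andP[c1 c2] := frac_le_bounds t e e0.
have cv := spectral_symbol_real _ Ag (continuous_ramp t e)
  (compact_support_ramp t e e0).
apply: filterS (cvgr_dist_le _ _ cv _ eps0) => n /=.
by rewrite ler_distlC; lra.
Qed.

Lemma rho_le_p_m : (rho A <= p_m mu D g)%E.
Proof.
apply: le_p_m_sublevel => t t0; apply/lee_addgt0Pr => e e0.
(* One half is the width of the ramp, the other the error in the limit of the means. *)
have e20 : 0 < e / 2 by rewrite divr_gt0.
apply: limn_esup_near_le; near=> n.
have n0 : (0 < n)%N by near: n; exact: nbhs_infty_gt.
have : frac_le t - e / 2 <= mean_sv (A n) (ramp t (e / 2))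
    <= frac_le (t + e / 2) + e / 2.
  by near: n; exact: mean_sv_ramp_near.
have := p_mx_ramp_le (A n) _ _ t0 e20 n0.
by rewrite -EFinD lee_fin; lra.
Unshelve. all: by end_near. Qed.

Lemma p_m_le_rho : (p_m mu D g <= rho A)%E.
Proof.
(* The three thirds pay for the limit of the means, the width of the ramp and the rounding of [t] to
   the grid of multiples of [h]. *)
apply/lee_addgt0Pr => e e0; pose h := e / 3.
have h0 : 0 < h by rewrite divr_gt0.
rewrite -leeBlDr//; apply: le_limn_esup_near.
pose K := (Num.trunc h^-1).+2.
near=> n.
have n0 : (0 < n)%N by near: n; exact: nbhs_infty_gt.
(* The bound is needed at all grid points at once, because [t] is only known after [n]; finitely
   many eventual bounds hold together. *)
have mean_le : forall k : 'I_K,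
    mean_sv (A n) (ramp (k%:R * h) h) <= frac_le (k%:R * h + h) + h.
  near: n; apply: filter_forall => k.
  by apply: filterS (mean_sv_ramp_near (k%:R * h) h h h0 h0) => n /andP[].
have [t /andP[t0 t1] pge] := ge_p_mx_ramp (A n) n0.
(* Rounding up gives [t < k%:R * h <= t + h], and [t <= 1] gives [k < K]. *)
pose k := (Num.trunc (t / h)).+1.
have /truncn_itv /andP[] : 0 <= t / h by rewrite divr_ge0// ltW.
rewrite ler_pdivlMr// ltr_pdivrMr// -/k => kt tk.
have kK : (k < K)%N.
  by rewrite !ltnS le_truncn// ler_pdivrMr// mulVf// gt_eqF.
have /= mean_lt := mean_le (Ordinal kK).
have mean_ge := pge _ _ (ltW tk) h0.
have kh0 : 0 <= k%:R * h + h by rewrite addr_ge0 ?mulr_ge0// ltW.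
rewrite EFinN leeBlDr//.
apply: le_trans (p_m_le_sublevel _ kh0) _.
rewrite -EFinD lee_fin.
have : k%:R * h <= t + h by rewrite /k -natr1 mulrDl mul1r lerD2r.
have eE : e = h + h + h by rewrite /h; lra.
lra.
Unshelve. all: by end_near. Qed.

End distribution_function.

Theorem theorem2p2 (R : realType) (d : nat) (D : set (lebesgue_Rd R d))
    (mD : measurable D)
    (D_gt0 : (0 < lebesgue_measure_Rd R d D)%E)
    (D_fin : (lebesgue_measure_Rd R d D < +oo)%E)
    (A : forall n : nat, 'M[R[i]]_n)
    (g : lebesgue_Rd R d -> borelC R)
    (mg : measurable_fun D g) :
  spectral_symbol (lebesgue_measure_Rd R d) D A g ->
  rho A = p_m (lebesgue_measure_Rd R d) D g.
Proof.
move=> Ag; apply/le_anti/andP; split; [exact: rho_le_p_m|exact: p_m_le_rho].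
Qed.
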